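(* The proof system $\mathbb{SKH}$ is strongly complete: for every set $\Gamma$ of formulas and every formula $\varphi$, if $\Gamma\vDash\varphi$ then $\Gamma\vdash\varphi$. Here $\Gamma\vDash\varphi$ means that for every model $\mathcal{M}$ and state $s$ of $\mathcal{M}$, if $\mathcal{M},s\vDash\gamma$ for all $\gamma\in\Gamma$ then $\mathcal{M},s\vDash\varphi$; and $\Gamma\vdash\varphi$ means that there are finitely many $\gamma_1,\dots,\gamma_n\in\Gamma$ ($n\ge 0$) such that $\gamma_1\wedge\cdots\wedge\gamma_n\to\varphi$ is derivable in $\mathbb{SKH}$ (for $n=0$, that $\varphi$ is derivable in $\mathbb{SKH}$).
   Context: **Language.** $\mathrm{PROP}$ is a countably infinite set of propositional symbols. Formulas: $\phi ::= p\mid\neg\phi\mid(\phi\wedge\phi)\mid\mathcal{K}\phi\mid\mathcal{K}h\,\phi$ with $p\in\mathrm{PROP}$; $\bot,\vee,\to$ are the usual abbreviations. **Models.** A model is $\mathcal{M}=\langle W,\mathrm{ACT},\sim,\{\xrightarrow{a}\mid a\in\mathrm{ACT}\},V\rangle$ where $W$ is a non-empty set, $\mathrm{ACT}$ is a set of actions, $\sim$ is an equivalence relation on $W$, each $\xrightarrow{a}$ is a binary relation on $W$, and $V:W\to 2^{\mathrm{PROP}}$. No relationship between $\sim$ and the $\xrightarrow{a}$ is assumed. $[s]$ is the $\sim$-class of $s$ and $[W]$ the set of all $\sim$-classes. An action $a$ is executable at a state $s$ if $s\xrightarrow{a}t$ for some $t$. Write $[s]\xrightarrow{a}[t]$ if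 there are $s'\in[s]$, $t'\in[t]$ with $s'\xrightarrow{a}t'$. **Strategies.** A strategy is a partial function $\sigma:[W]\to\mathrm{ACT}$ with domain $\mathrm{dom}(\sigma)$ such that for every $[s]\in\mathrm{dom}(\sigma)$ the action $\sigma([s])$ is executable at every $s'\in[s]$. The empty function is a strategy. **Executions.** A possible execution of $\sigma$ is a non-empty, finite or infinite, sequence $[s_0][s_1]\cdots$ of classes such that for every $i$ for which $[s_{i+1}]$ occurs in the sequence, $[s_i]\in\mathrm{dom}(\sigma)$ and $[s_i]\xrightarrow{\sigma([s_i])}[s_{i+1}]$. For a finite execution $[s_0]\cdots[s_n]$, $[s_n]$ is its leaf-node. An execution is complete if it is infinite or its leaf-node is not in $\mathrm{dom}(\sigma)$. $\mathrm{CELeaf}(\sigma,s)$ is the set of all leaf-nodes of (finite) complete executions of $\sigma$ starting from $[s]$. **Semantics.** $\mathcal{M},s\vDash p$ iff $p\in V(s)$; Boolean cases as usual; $\mathcal{M},s\vDash\mathcal{K}\phi$ iff $\mathcal{M},s'\vDash\phi$ for all $s'\sim s$; $\mathcal{M},s\vDash\mathcal{K}h\,\phi$ iff there is a strategy $\sigma$ such that (1) $[t]\subseteq\{u\in W\mid\mathcal{M},u\vDash\phi\}$ for all $[t]\in\mathrm{CELeaf}(\sigma,s)$, and (2) all complete executions of $\sigma$ starting from $[s]$ are finite. **System $\mathbb{SKH}$.** Axioms (with $p,q$ distinct propositional symbols): all axioms of propositional logic (all propositional tautologies); $\mathcal{K}p\wedge\mathcal{K}(p\to q)\to\mathcal{K}q$;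 $\mathcal{K}p\to p$; $\mathcal{K}p\to\mathcal{K}\mathcal{K}p$; $\neg\mathcal{K}p\to\mathcal{K}\neg\mathcal{K}p$; $\mathcal{K}p\to\mathcal{K}h\,p$; $\mathcal{K}h\,p\to\mathcal{K}h\,\mathcal{K}p$; $\mathcal{K}h\,p\to\mathcal{K}\mathcal{K}h\,p$; $\mathcal{K}h\,\mathcal{K}h\,p\to\mathcal{K}h\,p$; $\mathcal{K}h\,\bot\to\bot$. Rules: from $\varphi$ and $\varphi\to\psi$ infer $\psi$; from $\varphi$ infer $\mathcal{K}\varphi$; from $\varphi\to\psi$ infer $\mathcal{K}h\,\varphi\to\mathcal{K}h\,\psi$; from $\varphi(p)$ infer $\varphi[\psi/p]$ (uniform substitution of $\psi$ for $p$). *)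

(* Defs.v *)
From Stdlib Require List.
From mathcomp Require Import all_boot.
From mathcomp Require Import classical_sets.

Set Implicit Arguments.
Unset Strict Implicit.
Unset Printing Implicit Defensive.

Local Open Scope classical_set_scope.

Inductive form (PROP : Type) : Type :=
  | Var of PROP
  | Neg of form PROP
  | And of form PROP & form PROP
  | K of form PROP
  | Kh of form PROP.

Arguments Var {PROP} p.

Definition Imp (PROP : Type) (phi psi : form PROP) : form PROP :=
  Neg (And phi (Neg psi)).

(* No propositional symbol of an abstract [PROP] is distinguished, so the
   abbreviation of falsum is indexed by the symbol used to write it. *)
Definition Bot (PROP : Type) (p : PROP) : form PROP :=
  And (Var p) (Neg (Var p)).

Record model (PROP : Type) : Type := Model {
  state :> Type;
  state_inhabited : inhabited state;
  action : Type;
  indist : state -> state -> Prop;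
  indist_equiv : RelationClasses.Equivalence indist;
  step : action -> state -> state -> Prop;
  valuation : state -> set PROP
}.

Section Strategies.
Variables (PROP : Type) (M : model PROP).

Definition executable (a : action M) (s : M) : Prop := exists t : M, step a s t.

(* The set [W] of all equivalence classes. *)
Record eclass : Type := EClass {
  members : set M;
  eclassP : exists s : M, members = [set t | indist s t]
}.

Definition eclass_of (s : M) : eclass := EClass (ex_intro _ s erefl).

Definition class_step (a : action M) (X Y : eclass) : Prop :=
  exists s t : M, [/\ members X s, members Y t & step a s t].

(* A partial function is an [option]-valued one, undefined where it is [None]. *)
Record strategy : Type := Strategy {
  strat :> eclass -> option (action M);
  strategyP : forall (X : eclass) (a : action M),
    strat X = Some a -> forall s : M, members X s -> executable a s
}.

(* A finite or infinite sequence is a map [e : nat -> option eclass] where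
   [e i = Some X] means that the i-th item exists and is [X]. The second clause
   forces the items that exist to form an initial segment of [nat]. *)
Definition possible_execution (sigma : strategy) (e : nat -> option eclass) :
    Prop :=
  e 0 <> None /\
  forall (i : nat) (Y : eclass), e i.+1 = Some Y ->
    exists (X : eclass) (a : action M),
      [/\ e i = Some X, sigma X = Some a & class_step a X Y].

Definition finite_execution (e : nat -> option eclass) : Prop :=
  exists n : nat, e n = None.

Definition leaf_node (e : nat -> option eclass) (X : eclass) : Prop :=
  exists n : nat, e n = Some X /\ e n.+1 = None.

Definition complete_execution (sigma : strategy) (e : nat -> option eclass) :
    Prop :=
  possible_execution sigma e /\
  (~ finite_execution e \/
   exists X : eclass, leaf_node e X /\ sigma X = None).

Definition CELeaf (sigma : strategy) (s : M) : set eclass :=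
  [set X | exists e : nat -> option eclass,
     [/\ complete_execution sigma e, e 0 = Some (eclass_of s)
       & leaf_node e X]].

End Strategies.

Fixpoint sat (PROP : Type) (M : model PROP) (phi : form PROP) (s : M) : Prop :=
  match phi with
  | Var p => valuation s p
  | Neg psi => ~ sat psi s
  | And psi chi => sat psi s /\ sat chi s
  | K psi => forall t : M, indist s t -> sat psi t
  | Kh psi => exists sigma : strategy M,
      (forall X : eclass M, CELeaf sigma s X ->
         members X `<=` [set u | sat psi u]) /\
      (forall e : nat -> option (eclass M),
         complete_execution sigma e -> e 0 = Some (eclass_of s) ->
         finite_execution e)
  end.

Definition entails (PROP : Type) (Gamma : set (form PROP)) (phi : form PROP) :
    Prop :=
  forall (M : model PROP) (s : M),
    (forall gamma : form PROP, Gamma gamma -> sat gamma s) -> sat phi s.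

(* Symbols and formulas of the form [K _] and [Kh _] are the propositional
   atoms of a formula. *)
Fixpoint bool_eval (PROP : Type) (v : form PROP -> bool) (phi : form PROP) :
    bool :=
  match phi with
  | Neg psi => ~~ bool_eval v psi
  | And psi chi => bool_eval v psi && bool_eval v chi
  | Var _ | K _ | Kh _ => v phi
  end.

Definition tautology (PROP : Type) (phi : form PROP) : Prop :=
  forall v : form PROP -> bool, bool_eval v phi.

Fixpoint subst (PROP : eqType) (p : PROP) (psi phi : form PROP) : form PROP :=
  match phi with
  | Var q => if q == p then psi else Var q
  | Neg chi => Neg (subst p psi chi)
  | And chi1 chi2 => And (subst p psi chi1) (subst p psi chi2)
  | K chi => K (subst p psi chi)
  | Kh chi => Kh (subst p psi chi)
  end.

Inductive SKH (PROP : eqType) : form PROP -> Prop :=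
  | SKH_taut phi : tautology phi -> SKH phi
  | SKH_distK (p q : PROP) : p != q ->
      SKH (Imp (And (K (Var p)) (K (Imp (Var p) (Var q)))) (K (Var q)))
  | SKH_T (p : PROP) : SKH (Imp (K (Var p)) (Var p))
  | SKH_4 (p : PROP) : SKH (Imp (K (Var p)) (K (K (Var p))))
  | SKH_5 (p : PROP) : SKH (Imp (Neg (K (Var p))) (K (Neg (K (Var p)))))
  | SKH_KtoKh (p : PROP) : SKH (Imp (K (Var p)) (Kh (Var p)))
  | SKH_KhtoKhK (p : PROP) : SKH (Imp (Kh (Var p)) (Kh (K (Var p))))
  | SKH_KhtoKKh (p : PROP) : SKH (Imp (Kh (Var p)) (K (Kh (Var p))))
  | SKH_KhKh (p : PROP) : SKH (Imp (Kh (Kh (Var p))) (Kh (Var p)))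
  | SKH_Khbot (p : PROP) : SKH (Imp (Kh (Bot p)) (Bot p))
  | SKH_MP phi psi : SKH phi -> SKH (Imp phi psi) -> SKH psi
  | SKH_NecK phi : SKH phi -> SKH (K phi)
  | SKH_MonoKh phi psi : SKH (Imp phi psi) -> SKH (Imp (Kh phi) (Kh psi))
  | SKH_Sub (p : PROP) (psi phi : form PROP) : SKH phi -> SKH (subst p psi phi).

Definition conj_imp (PROP : Type) (gs : seq (form PROP)) (phi : form PROP) :
    form PROP :=
  if gs is g :: gs' then Imp (foldl (@And PROP) g gs') phi else phi.

Definition derivable_from (PROP : eqType) (Gamma : set (form PROP))
    (phi : form PROP) : Prop :=
  exists gs : seq (form PROP),
    List.Forall Gamma gs /\ SKH (conj_imp gs phi).

(* Main.v *)
(** Canonical model.  The states are all the maximal consistent sets, two of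
them being indistinguishable when they contain the same formulas [K phi]; the
actions are the formulas, and [phi] leads from [A] to [B] when [Kh phi] is in
[A] and [K phi] is in [B].  If [Kh phi] is in [A], doing [phi] once at [[A]]
(nothing if [K phi] is already in [A]) is a winning strategy.  Conversely, if
[Kh psi] is not in [A], a strategy defined at [[A]] has an outcome that lacks
[Kh psi] as well, for otherwise [K phi -> Kh psi] would be derivable, hence
[Kh phi -> Kh K phi -> Kh Kh psi -> Kh psi]; so some complete execution is
infinite or ends in a class without [Kh psi], hence without [K psi]. *)
Require Import Defs.
From mathcomp Require Import all_boot.
From mathcomp Require Import boolp classical_sets.

Set Implicit Arguments.
Unset Strict Implicit.
Unset Printing Implicit Defensive.

Local Open Scope classical_set_scope.

(** * Fresh symbols, substitution and Boolean evaluation *)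

Lemma infinite_fresh (T : eqType) (f : nat -> T) (s : seq T) :
  bijective f -> exists q, q \notin s.
Proof.
case=> g fK gK; exists (f (\max_(x <- s) g x).+1).
apply/negP => sf; have := leq_bigmax_seq (P := xpredT) (F := g) _ sf isT.
by rewrite fK ltnn.
Qed.

Fixpoint symbols (PROP : Type) (phi : form PROP) : seq PROP :=
  match phi with
  | Var p => [:: p]
  | Neg psi | K psi | Kh psi => symbols psi
  | And psi chi => symbols psi ++ symbols chi
  end.

Lemma subst_fresh (PROP : eqType) (p : PROP) (psi phi : form PROP) :
  p \notin symbols phi -> subst p psi phi = phi.
Proof.
elim: phi => /= [q|phi IH|phi1 IH1 phi2 IH2|phi IH|phi IH].
- by rewrite inE eq_sym => /negPf->.
- by move/IH->.
- by rewrite mem_cat negb_or => /andP[/IH1-> /IH2->].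
- by move/IH->.
- by move/IH->.
Qed.

Lemma bool_eval_Imp (PROP : Type) v (phi psi : form PROP) :
  bool_eval v (Imp phi psi) = (bool_eval v phi ==> bool_eval v psi).
Proof. by rewrite /=; case: bool_eval; case: bool_eval. Qed.

Lemma bool_eval_conj_imp (PROP : Type) v gs (phi : form PROP) :
  bool_eval v (conj_imp gs phi) = (all (bool_eval v) gs ==> bool_eval v phi).
Proof.
case: gs => [//|g gs]; rewrite [conj_imp _ _]/= bool_eval_Imp; congr (_ ==> _).
elim: gs g => [|h gs IH] g /=; first by rewrite andbT.
by rewrite IH /= andbA.
Qed.

Lemma bool_eval_foldr_Imp (PROP : Type) v gs (phi : form PROP) :
  bool_eval v (foldr (@Imp PROP) phi gs) =
  (all (bool_eval v) gs ==> bool_eval v phi).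
Proof.
elim: gs => [//|g gs IH]; rewrite [foldr _ _ _]/= bool_eval_Imp IH /=.
by case: bool_eval.
Qed.

(** * Derivability from a set and maximal consistent sets *)

Section Derivability.
Variable PROP : eqType.
Implicit Types (phi psi chi : form PROP) (G : set (form PROP)).

Lemma SKH_taut_conseq phi psi :
  SKH phi -> (forall v, bool_eval v phi -> bool_eval v psi) -> SKH psi.
Proof.
move=> dphi H; apply: (SKH_MP dphi); apply: SKH_taut => v.
by rewrite bool_eval_Imp; apply/implyP/H.
Qed.

Lemma SKH_Imp_trans phi psi chi :
  SKH (Imp phi psi) -> SKH (Imp psi chi) -> SKH (Imp phi chi).
Proof.
move=> d1 d2; apply: (SKH_MP d2); apply: (SKH_taut_conseq d1) => v.
by rewrite !bool_eval_Imp; do 3!case: bool_eval.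
Qed.

Lemma derivable_SKH G phi : SKH phi -> derivable_from G phi.
Proof. by move=> d; exists [::]; split=> //; constructor. Qed.

Lemma derivable_mem G phi : G phi -> derivable_from G phi.
Proof.
move=> Gphi; exists [:: phi]; split; first by repeat constructor.
by apply: SKH_taut => v; rewrite bool_eval_conj_imp /= andbT implybb.
Qed.

Lemma derivable_conseq2 G phi psi chi :
    derivable_from G phi -> derivable_from G psi ->
    (forall v, bool_eval v phi -> bool_eval v psi -> bool_eval v chi) ->
  derivable_from G chi.
Proof.
move=> [gs [Ggs dgs]] [hs [Ghs dhs]] H; exists (gs ++ hs); split.
  by apply/List.Forall_app.
apply: (SKH_MP dhs); apply: (SKH_taut_conseq dgs) => v.
rewrite bool_eval_Imp !bool_eval_conj_imp all_cat => /implyP vphi.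
apply/implyP => /implyP vpsi; apply/implyP => /andP[vgs vhs].
exact: H (vphi vgs) (vpsi vhs).
Qed.

Lemma deduction G phi psi :
  derivable_from (G `|` [set phi]) psi -> derivable_from G (Imp phi psi).
Proof.
case=> gs [Ggs dgs].
(* [hs] is [gs] without the copies of [phi] that come from the singleton. *)
have [hs [Ghs H]] : exists hs, List.Forall G hs /\
    forall v, bool_eval v phi -> all (bool_eval v) hs -> all (bool_eval v) gs.
  elim: Ggs {dgs} => [|g {}gs Gg _ [hs [Ghs H]]]; first by exists [::].
  case: Gg => [Gg|->].
    exists (g :: hs); split; first by constructor.
    by move=> v vphi /= /andP[-> /(H _ vphi)].
  by exists hs; split=> // v vphi /(H _ vphi) /= ->; rewrite vphi.
exists hs; split=> //; apply: (SKH_taut_conseq dgs) => v.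
rewrite !bool_eval_conj_imp bool_eval_Imp => /implyP vgs.
apply/implyP => vhs; apply/implyP => vphi; exact/vgs/H.
Qed.

(** Consistency is implicit: otherwise closure under derivability would put both a formula and its
    negation in [G]. *)
Definition mcs G : Prop :=
  (forall phi, derivable_from G phi -> G phi) /\
  (forall phi, G (Neg phi) <-> ~ G phi).

(** A finite list draws on finitely many members of the chain, and the largest of these contains the
    others. The left alternative covers the empty chain. *)
Lemma Forall_chain G (F : set (set (form PROP))) gs :
    total_on F subset -> List.Forall (G `|` \bigcup_(X in F) X) gs ->
  List.Forall G gs \/ exists2 X, F X & List.Forall (G `|` X) gs.
Proof.
move=> totF; elim=> [|g {}gs Gg _ IH]; first by left.
case: Gg => [Gg|[Y FY Yg]]; case: IH => [IH|[X FX IH]].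
- by left; constructor.
- by right; exists X => //; constructor=> //; left.
- right; exists Y => //; constructor; first by right.
  by apply: List.Forall_impl IH => ?; left.
- have [XY|YX] := totF _ _ FX FY.
    right; exists Y => //; constructor; first by right.
    by apply: List.Forall_impl IH => ? []; [left|right; apply: XY].
  by right; exists X => //; constructor=> //; right; apply: YX.
Qed.

Lemma lindenbaum G chi :
  ~ derivable_from G chi -> exists A, [/\ mcs A, G `<=` A & ~ A chi].
Proof.
move=> ndG.
(* [P] ranges over the sets added to [G], so that the union of the empty chain also lies in it. *)
pose P := [set A | ~ derivable_from (G `|` A) chi].
have [F FP totF|A [PA maxA]] := @Zorn_bigcup _ P.
  move=> [gs [/(Forall_chain totF)[Ggs|[X FX Xgs]] dgs]].
    by apply: ndG; exists gs.
  by apply: (FP _ FX); exists gs.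
set B := G `|` A in PA.
have dB phi : ~ B phi -> derivable_from B (Imp phi chi).
  move=> nBphi; apply: deduction; apply: contrapT => nd.
  apply: (maxA (A `|` [set phi])); last by rewrite /P /= setUA.
  split; first by move=> ?; left.
  by move/(_ phi (or_intror erefl)) => Aphi; apply: nBphi; right.
have closedB phi : derivable_from B phi -> B phi.
  move=> d; apply: contrapT => /dB dchi; apply: PA.
  apply: (derivable_conseq2 d dchi) => v.
  by rewrite bool_eval_Imp => ->.
exists B; split; [split=> //| by move=> ?; left | by move/derivable_mem].
move=> phi; split=> [nphi Bphi|nBphi].
  by apply: PA; apply: (derivable_conseq2 (derivable_mem nphi)
    (derivable_mem Bphi)) => v /= /negPf->.
(* If [B] contained neither [phi] nor its negation, both would imply [chi] over [B], and so [chi]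
   would be derivable. *)
apply: contrapT => /dB dn; apply: PA.
apply: (derivable_conseq2 (dB _ nBphi) dn) => v.
by rewrite !bool_eval_Imp /=; case: (bool_eval v phi).
Qed.

Section MaximalConsistentSet.
Variable A : set (form PROP).
Hypothesis mcsA : mcs A.

Lemma mcs_SKH phi : SKH phi -> A phi.
Proof. by move=> d; apply: mcsA.1; apply: derivable_SKH. Qed.

Lemma mcs_Neg phi : A (Neg phi) <-> ~ A phi.
Proof. exact: mcsA.2. Qed.

Lemma mcs_conseq2 phi psi chi : A phi -> A psi ->
  (forall v, bool_eval v phi -> bool_eval v psi -> bool_eval v chi) -> A chi.
Proof.
move=> Aphi Apsi H; apply: mcsA.1.
exact: derivable_conseq2 (derivable_mem Aphi) (derivable_mem Apsi) H.
Qed.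

Lemma mcs_MP phi psi : A (Imp phi psi) -> A phi -> A psi.
Proof.
move=> d Aphi; apply: (mcs_conseq2 d Aphi) => v.
by rewrite bool_eval_Imp => /implyP.
Qed.

Lemma mcs_SKH_MP phi psi : SKH (Imp phi psi) -> A phi -> A psi.
Proof. by move/mcs_SKH; apply: mcs_MP. Qed.

Lemma mcs_And phi psi : A (And phi psi) <-> A phi /\ A psi.
Proof.
split=> [d|[Aphi Apsi]].
  by split; apply: (mcs_conseq2 d d) => v /= /andP[].
by apply: (mcs_conseq2 Aphi Apsi) => v /= -> ->.
Qed.

End MaximalConsistentSet.

Lemma SKH_of_mcs phi : (forall A, mcs A -> A phi) -> SKH phi.
Proof.
move=> H; have [[gs [gs0 d]]|nd] := pselect (derivable_from set0 phi).
  by case: gs0 d.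
by have [A [/H]] := lindenbaum nd.
Qed.

End Derivability.

(** * Axiom schemes and modal properties of maximal consistent sets *)

Section CanonicalModel.
Variable PROP : eqType.
Hypothesis PROP_infinite : forall s : seq PROP, exists q, q \notin s.
Implicit Types (phi psi : form PROP) (A B : set (form PROP)).

(** The two symbols are replaced one after the other: [q] is chosen outside [phi] so that the second
    substitution leaves the inserted [phi] intact. *)
Lemma SKH_K_distr phi psi :
  SKH (Imp (And (K phi) (K (Imp phi psi))) (K psi)).
Proof.
have [p _] := PROP_infinite [::].
have [q] := PROP_infinite (p :: symbols phi).
rewrite inE negb_or eq_sym => /andP[pq qphi].
have := SKH_Sub q psi (SKH_Sub p phi (SKH_distK pq)).
by rewrite /= !eqxx eq_sym (negPf pq) /= eqxx !(subst_fresh _ qphi).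
Qed.

Lemma SKH_K_elim phi : SKH (Imp (K phi) phi).
Proof.
have [p _] := PROP_infinite [::].
by have := SKH_Sub p phi (SKH_T p); rewrite /= eqxx.
Qed.

Lemma SKH_K_pos_intro phi : SKH (Imp (K phi) (K (K phi))).
Proof.
have [p _] := PROP_infinite [::].
by have := SKH_Sub p phi (SKH_4 p); rewrite /= eqxx.
Qed.

Lemma SKH_K_neg_intro phi : SKH (Imp (Neg (K phi)) (K (Neg (K phi)))).
Proof.
have [p _] := PROP_infinite [::].
by have := SKH_Sub p phi (SKH_5 p); rewrite /= eqxx.
Qed.

Lemma SKH_K_Kh phi : SKH (Imp (K phi) (Kh phi)).
Proof.
have [p _] := PROP_infinite [::].
by have := SKH_Sub p phi (SKH_KtoKh p); rewrite /= eqxx.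
Qed.

Lemma SKH_Kh_KhK phi : SKH (Imp (Kh phi) (Kh (K phi))).
Proof.
have [p _] := PROP_infinite [::].
by have := SKH_Sub p phi (SKH_KhtoKhK p); rewrite /= eqxx.
Qed.

Lemma SKH_Kh_KKh phi : SKH (Imp (Kh phi) (K (Kh phi))).
Proof.
have [p _] := PROP_infinite [::].
by have := SKH_Sub p phi (SKH_KhtoKKh p); rewrite /= eqxx.
Qed.

Lemma SKH_KhKh_Kh phi : SKH (Imp (Kh (Kh phi)) (Kh phi)).
Proof.
have [p _] := PROP_infinite [::].
by have := SKH_Sub p phi (SKH_KhKh p); rewrite /= eqxx.
Qed.

(** The implication is curried before necessitation, so that [K] distributes over it one premise at
    a time. *)
Lemma mcs_K_conj_imp A gs phi : mcs A ->
  SKH (conj_imp gs phi) -> List.Forall (fun g => A (K g)) gs -> A (K phi).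
Proof.
move=> mcsA dgs Ags.
have : A (K (foldr (@Imp PROP) phi gs)).
  apply: (mcs_SKH mcsA); apply: SKH_NecK; apply: (SKH_taut_conseq dgs) => v.
  by rewrite bool_eval_conj_imp bool_eval_foldr_Imp.
elim: Ags => [//|g {dgs}gs Ag _ IH] /= H; apply: IH.
by apply: (mcs_SKH_MP mcsA (SKH_K_distr g _)); apply/(mcs_And mcsA).
Qed.

Definition canon_indist A B : Prop := forall phi, A (K phi) <-> B (K phi).

Lemma mcs_K_exists A phi : mcs A -> ~ A (K phi) ->
  exists B, [/\ mcs B, canon_indist A B & ~ B phi].
Proof.
move=> mcsA nAK.
(* Containing [G] forces indistinguishability from [A]. By positive and negative introspection, [A]
   contains [K g] for every [g] in [G], so deriving [phi] from [G] would put [K phi] in [A]. *)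
pose G := [set g | exists chi, (g = K chi /\ A (K chi)) \/
                               (g = Neg (K chi) /\ ~ A (K chi))].
have [|B [mcsB GB nB]] := @lindenbaum _ G phi.
  move=> [gs [Ggs dgs]]; apply/nAK/(mcs_K_conj_imp mcsA dgs).
  apply: List.Forall_impl Ggs => _ [chi [[-> Achi]|[-> nAchi]]].
    exact: (mcs_SKH_MP mcsA (SKH_K_pos_intro _)).
  by apply: (mcs_SKH_MP mcsA (SKH_K_neg_intro _)); apply/(mcs_Neg mcsA).
exists B; split=> // chi; split=> [Achi|Bchi].
  by apply: GB; exists chi; left.
apply: contrapT => nAchi; have : B (Neg (K chi)).
  by apply: GB; exists chi; right.
by move/(mcs_Neg mcsB).
Qed.

(** What lies in every maximal consistent set is derivable, so [Imp (K phi) psi] is a theorem and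
    the monotonicity rule applies. Hence [B] ranges over all such sets, not only those
    indistinguishable from [A]. *)
Lemma mcs_Kh_mono A phi psi : mcs A -> A (Kh phi) ->
  (forall B, mcs B -> B (K phi) -> B psi) -> A (Kh psi).
Proof.
move=> mcsA Aphi H; have d : SKH (Imp (K phi) psi).
  apply: SKH_of_mcs => B mcsB.
  have [/(H _ mcsB) Bpsi|/(mcs_Neg mcsB) nB] := pselect (B (K phi)).
    by apply: (mcs_conseq2 mcsB Bpsi Bpsi) => v; rewrite bool_eval_Imp => ->;
       rewrite implybT.
  by apply: (mcs_conseq2 mcsB nB nB) => v; rewrite bool_eval_Imp;
     move=> /negPf /= ->.
apply: (mcs_SKH_MP mcsA (SKH_MonoKh d)).
exact: (mcs_SKH_MP mcsA (SKH_Kh_KhK _)).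
Qed.

(** This makes the action [phi] executable. Without a target, [K phi] would imply falsum, and [A]
    would contain [Kh] of falsum. *)
Lemma mcs_Kh_witness A phi : mcs A -> A (Kh phi) ->
  exists2 B, mcs B & B (K phi).
Proof.
move=> mcsA Aphi; apply: contrapT => nB.
have [p _] := PROP_infinite [::].
have : A (Bot p).
  apply: (mcs_SKH_MP mcsA (SKH_Khbot p)); apply: (mcs_Kh_mono mcsA Aphi).
  by move=> B mcsB BK; case: nB; exists B.
by move/(mcs_And mcsA) => [Ap /(mcs_Neg mcsA)].
Qed.

(** * The canonical model *)

Definition canon_state : Type := {A : set (form PROP) | mcs A}.

Lemma canon_indist_equiv :
  RelationClasses.Equivalence
    (fun s t : canon_state => canon_indist (sval s) (sval t)).
Proof.
split=> [s phi //|s t st phi|s t u st tu phi].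
- by symmetry; apply: st.
- by rewrite st tu.
Qed.

Definition canon_model (w : inhabited canon_state) : model PROP :=
  {| state := canon_state;
     state_inhabited := w;
     action := form PROP;
     indist := fun s t => canon_indist (sval s) (sval t);
     indist_equiv := canon_indist_equiv;
     step := fun phi s t => sval s (Kh phi) /\ sval t (K phi);
     valuation := fun s p => sval s (Var p) |}.

(** * The truth lemma *)

Section TruthLemma.
Variable w : inhabited canon_state.
Let M := canon_model w.
Implicit Types (s t : M) (X Y : eclass M).

Lemma members_indist X s t :
  members X s -> members X t -> canon_indist (sval s) (sval t).
Proof.
case: (eclassP X) => r -> /= rs rt phi.
by rewrite -(rs phi) (rt phi).
Qed.

Lemma members_indist_trans X s t :
  members X s -> canon_indist (sval s) (sval t) -> members X t.
Proof. by case: (eclassP X) => r -> /= rs st phi; rewrite (rs phi). Qed.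

Lemma mem_eclass_of s : members (eclass_of s) s.
Proof. by []. Qed.

Lemma mcs_K_indist s phi :
  sval s (K phi) <-> forall t, canon_indist (sval s) (sval t) -> sval t phi.
Proof.
split=> [sK t /(_ phi) st|H].
  by apply: (mcs_SKH_MP (svalP t) (SKH_K_elim phi)); apply/st.
apply: contrapT => /(mcs_K_exists (svalP s))[B [mcsB sB nB]].
exact/nB/(H (exist _ B mcsB)).
Qed.

Lemma indist_Kh s t phi :
  canon_indist (sval s) (sval t) -> sval s (Kh phi) -> sval t (Kh phi).
Proof.
move=> st /(mcs_SKH_MP (svalP s) (SKH_Kh_KKh phi)) /st.
exact: (mcs_SKH_MP (svalP t) (SKH_K_elim _)).
Qed.

Definition once (s : M) phi X : option (form PROP) :=
  if `[< X = eclass_of s /\ ~ sval s (K phi) >] then Some phi else None.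

Lemma once_executable s phi : sval s (Kh phi) ->
  forall X a, once s phi X = Some a ->
  forall t : M, members X t -> executable (a : action M) t.
Proof.
move=> sKh X a; rewrite /once; case: asboolP => // -[-> _] [<-] t st.
have tKh : sval t (Kh phi) by apply: indist_Kh sKh.
have [B mcsB BK] := mcs_Kh_witness (svalP t) tKh.
by exists (exist _ B mcsB).
Qed.

Lemma Kh_sat_of_mcs s phi : (forall t, sat phi t <-> sval t phi) ->
  sval s (Kh phi) -> sat (Kh phi) s.
Proof.
move=> IH sKh.
pose sigma : strategy M := Strategy (once_executable sKh).
have stepE (e : nat -> option (eclass M)) i Y : possible_execution sigma e ->
    e i.+1 = Some Y -> [/\ e i = Some (eclass_of s), ~ sval s (K phi)
                         & exists2 t, members Y t & sval t (K phi)].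
  move=> [_ H] /H[X [a [-> /=]]]; rewrite /once.
  case: asboolP => // -[-> nK] [<-] [t [u [_ Yu [_ uK]]]].
  by split=> //; exists u.
(* A third class would require the second one to be the class of [s], although it has a member
   containing [K phi]. *)
have stop (e : nat -> option (eclass M)) i :
    possible_execution sigma e -> e i.+2 = None.
  move=> pe; case eY : (e i.+2) => [Y|//].
  have [e1 nK _] := stepE _ _ _ pe eY.
  have [_ _ [t st tK]] := stepE _ _ _ pe e1.
  by case: nK; apply/st.
exists sigma; split=> [X [e [[pe ce] e0 [n [en en1]]]] t Xt|e [pe _] _].
  apply/IH.
  have known u : members X u -> sval u (K phi) -> sval t phi.
    move=> Xu uK; apply: (mcs_SKH_MP (svalP t) (SKH_K_elim phi)).
    exact/(members_indist Xu Xt).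
  case: n en en1 => [|n] en en1; last first.
    by have [_ _ [u]] := stepE _ _ _ pe en; apply: known.
  have {en}X_s : X = eclass_of s by move: en; rewrite e0 => -[].
  rewrite X_s in known.
  apply: (known s (mem_eclass_of s)); apply: contrapT => nK.
  (* The leaf is the class of [s] itself, so [e 1] is [None]. Completeness yields a leaf at some
     index [m]; only [m = 0] is possible, and there [sigma] is defined because [K phi] is not in
     [s]. *)
  case: ce => [[]|[Y [[m [em em1]] sY]]]; first by exists 1.
  case: m em em1 => [|[|m]] em em1.
  - move: em sY; rewrite e0 /= /once => -[<-].
    by case: asboolP => // -[].
  - by rewrite em in en1.
  - by rewrite stop in em.
by exists 2; apply: stop.
Qed.

Lemma Kh_mcs_of_sat s psi : (forall t, sat psi t <-> sval t psi) ->
  sat (Kh psi) s -> sval s (Kh psi).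
Proof.
move=> IH [sigma [leafP finP]]; apply: contrapT => nKh.
pose bad X := exists2 t, members X t & ~ sval t (Kh psi).
(* [next] picks a bad successor wherever [sigma] is defined on a bad class and stops where it is
   undefined; elsewhere its value is irrelevant. *)
have /choice[next nextP] (X : eclass M) : exists oY : option (eclass M),
    bad X -> if sigma X is Some a
      then exists Y, [/\ oY = Some Y, class_step a X Y & bad Y]
      else oY = None.
  have [[t Xt nt]|] := pselect (bad X); last by exists None.
  case sX : (sigma X) => [a|]; last by exists None.
  (* Only executability at [t] matters: it puts [Kh a] in [t]. The successor [u] need not be bad and
     is replaced by [b]. *)
  have [u [tKh _]] := strategyP sX Xt.
  have [B mcsB [BK nB]] : exists2 B, mcs B & B (K a) /\ ~ B (Kh psi).
    apply: contrapT => noB; apply: nt.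
    apply: (mcs_SKH_MP (svalP t) (SKH_KhKh_Kh psi)).
    apply: (mcs_Kh_mono (svalP t) tKh) => B mcsB BK.
    by apply: contrapT => nB; apply: noB; exists B.
  pose b : M := exist _ B mcsB.
  exists (Some (eclass_of b)); move=> _; exists (eclass_of b); split=> //.
    by exists t, b.
  by exists b.
pose e := fun i => iter i (obind next) (Some (eclass_of s)).
have eS i : e i.+1 = obind next (e i) by [].
have e_bad i X : e i = Some X -> bad X.
  elim: i X => [X [<-]|i IHi X]; first by exists s.
  rewrite eS; case eY : (e i) => [Y|//] /= nY.
  have := nextP _ (IHi _ eY); case: (sigma Y) => [a|]; last by rewrite nY.
  by case=> Z []; rewrite nY => -[<-].
have e_possible : possible_execution sigma e.
  split=> // i Y; rewrite eS; case eX : (e i) => [X|//] /= nX.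
  have := nextP _ (e_bad _ _ eX).
  case sX : (sigma X) => [a|]; last by rewrite nX.
  by case=> Z []; rewrite nX => -[<-] XY _; exists X, a.
have leaf_end X : leaf_node e X -> sigma X = None.
  move=> [n [eX]]; rewrite eS eX /= => nX.
  have := nextP _ (e_bad _ _ eX); case: (sigma X) => // a [Z []].
  by rewrite nX.
(* Since [e 0] is defined, the first undefined item comes right after a leaf. *)
have has_leaf : finite_execution e -> exists X, leaf_node e X.
  case; elim=> [//|n IHn] en1.
  by case en : (e n) => [X|]; [exists X, n|exact: IHn].
have e_complete : complete_execution sigma e.
  split=> //; have [/has_leaf[X lX]|] := pselect (finite_execution e).
    by right; exists X; split=> //; apply: leaf_end.
  by left.
have [X lX] := has_leaf (finP e e_complete erefl).
have [n [/e_bad[t Xt nt] _]] := lX.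
(* The leaf is bad, yet winning makes [psi] true throughout it, so [t] contains [K psi] and hence
   [Kh psi]. *)
apply/nt/(mcs_SKH_MP (svalP t) (SKH_K_Kh psi)); apply/mcs_K_indist => u tu.
apply/IH/(leafP X); first by exists e.
exact: members_indist_trans tu.
Qed.

Lemma truth_lemma phi s : sat phi s <-> sval s phi.
Proof.
elim: phi s => [p|phi IH|phi1 IH1 phi2 IH2|phi IH|phi IH] s //=.
- by rewrite (mcs_Neg (svalP s)) IH.
- by rewrite (mcs_And (svalP s)) IH1 IH2.
- rewrite mcs_K_indist.
  by split=> H t st; apply/IH/H.
- by split; [apply: Kh_mcs_of_sat|apply: Kh_sat_of_mcs].
Qed.

End TruthLemma.
End CanonicalModel.

Theorem theorem4p9 (PROP : eqType)
    (PROP_countably_infinite : exists f : nat -> PROP, bijective f)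
    (Gamma : set (form PROP)) (phi : form PROP) :
  entails Gamma phi -> derivable_from Gamma phi.
Proof.
move=> ent; apply: contrapT => /lindenbaum[A [mcsA GA nA]].
have [f f_bij] := PROP_countably_infinite.
(* The set omitting [phi] serves both as the refuting state and as the witness that the canonical
   model is non-empty. *)
pose s : canon_state PROP := exist _ A mcsA.
have truth := @truth_lemma _ (fun l => infinite_fresh l f_bij) (inhabits s).
apply: nA; apply/(truth phi s)/ent => g Gg.
exact/truth/GA.
Qed.
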